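(* Let $r\ge 2$ be an integer, and define $a:\mathbb{Z}\to\mathbb{Z}$ by $a(n)=\left\lfloor \frac{n}{\sqrt{r}}+\frac{\sqrt{r}}{2}\right\rfloor$, and $S(n)=\sum_{j=0}^{r-1}a(n-j)$. If $r$ is not an even perfect square (i.e. not of the form $r=s^2$ with $s$ even), then $a(S(n))=n$ for all integers $n\ge r$. If $r=s^{2}$ with $s$ even, then $a(S(n))=n+1$ for all integers $n\ge r$. In particular, when $r=s^2$ with $s$ odd, $a(S(n))=n$ for all $n\ge r$. *)

(* Defs.v *)
From mathcomp Require Import all_boot all_order all_algebra.
From mathcomp Require Import reals.

Set Implicit Arguments.
Unset Strict Implicit.
Unset Printing Implicit Defensive.

Import Order.TTheory GRing.Theory Num.Theory.

Local Open Scope ring_scope.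

Definition aseq (R : realType) (r : nat) (n : int) : int :=
  Num.floor (n%:~R / Num.sqrt (r%:R : R) + Num.sqrt (r%:R : R) / 2).

Definition Ssum (R : realType) (r : nat) (n : int) : int :=
  \sum_(j < r) aseq R r (n - j%:Z).

Definition even_square (r : nat) : Prop :=
  exists s : nat, ~~ odd s /\ r = (s ^ 2)%N.

(* Main.v *)
Require Import Defs.
From mathcomp Require Import all_boot all_order all_algebra.
From mathcomp Require Import reals.
From mathcomp Require Import ring lra zify.

Import Order.TTheory GRing.Theory Num.Theory.

Local Open Scope ring_scope.

(** Write t = sqrt r and p_j = (n - j) / t + t / 2.  Since the p_j sum to
    t n + t / 2, the value of a(S(n)) is read off from the sum of the fractional
    parts {p_j}, which has to be within t / 2 of r / 2.  Measuring all p_j from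
    the one with the smallest (resp. largest) fractional part reduces this to an
    upper bound for the sum over j < r of floor ((j - i) / t), for each i < r.
    Lattice-point counting turns that into sums of floor (l t) and ceil (l t)
    with l <= s = floor t, and with e = t - s the bound becomes
      t e (1 - e) / 2 <= sum_(l < k) {l t} + sum_(1 <= l <= s - k) {- l t}
                         + e {k t}.
    The sums on the right are at least 1 - e for each carry of l e past an
    integer, there are about s e carries, and t e (1 - e) / 2 is about half as
    much as that gives; only the cases of at most one carry need care.
    The value n + 1 is reached only if some p_j is an integer.  As n >= r, this
    makes 2 (n - j) + r = 2 t p_j positive, so t is rational, and even by parity. *)

(** * Sums of floors and ceilings of multiples of [t] *)

Section BeattySums.
Variable R : archiRealFieldType.
Implicit Types (t x y : R) (i j k l s r N : nat).

Lemma floor_add_cases t x s : s%:R <= t < s%:R + 1 ->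
  (Num.floor (x + t))%:~R = (Num.floor x)%:~R + s%:R :> R \/
  (Num.floor (x + t))%:~R = (Num.floor x)%:~R + s%:R + 1 :> R.
Proof.
move=> /andP[st ts]; have /andP[fx xf] := floor_itv x; rewrite intrD in xf.
have [h|h] := ltP (x + t) ((Num.floor x)%:~R + s%:R + 1); [left|right].
  rewrite (_ : Num.floor (x + t) = Num.floor x + s%:Z) ?intrD //.
  by apply: floor_def; rewrite ?intrB !intrD -!pmulrn; lra.
rewrite (_ : Num.floor (x + t) = Num.floor x + s%:Z + 1) ?intrD //.
by apply: floor_def; rewrite ?intrB !intrD -!pmulrn; lra.
Qed.

Lemma ceil_add_cases t x s : s%:R <= t < s%:R + 1 ->
  (Num.ceil (x + t))%:~R = (Num.ceil x)%:~R + s%:R :> R \/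
  (Num.ceil (x + t))%:~R = (Num.ceil x)%:~R + s%:R + 1 :> R.
Proof.
move=> /andP[st ts]; have /andP[fx xf] := ceil_itv x; rewrite intrB in fx.
have [h|h] := leP (x + t) ((Num.ceil x)%:~R + s%:R); [left|right].
  rewrite (_ : Num.ceil (x + t) = Num.ceil x + s%:Z) ?intrD //.
  by apply: ceil_def; rewrite ?intrB !intrD -!pmulrn; lra.
rewrite (_ : Num.ceil (x + t) = Num.ceil x + s%:Z + 1) ?intrD //.
by apply: ceil_def; rewrite ?intrB !intrD -!pmulrn; lra.
Qed.

(* When floor (l t) jumps by s + 1 rather than s, {l t} is at least s + 1 - t. *)
Lemma sum_frac_ge t s k : s%:R <= t < s%:R + 1 ->
  (s%:R + 1 - t) * ((Num.floor (k%:R * t))%:~R - k%:R * s%:R)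
    <= \sum_(l < k) (l%:R * t - (Num.floor (l%:R * t))%:~R).
Proof.
move=> st; elim: k => [|k IH]; first by rewrite big_ord0 !mul0r floor0; lra.
have := floor_le (k%:R * t); have := floor_le (k.+1%:R * t).
rewrite big_ord_recr /= -natr1 mulrDl mul1r.
by have [->|->] := floor_add_cases _ (k%:R * t) _ st; nra.
Qed.

Lemma sum_ceil_ge t s k : s%:R <= t < s%:R + 1 ->
  (s%:R + 1 - t) * ((Num.ceil (k%:R * t))%:~R - k%:R * s%:R)
    <= \sum_(l < k) ((Num.ceil (l.+1%:R * t))%:~R - l.+1%:R * t).
Proof.
move=> st; elim: k => [|k IH]; first by rewrite big_ord0 !mul0r ceil0; lra.
have := ceil_ge (k%:R * t); have := ceil_ge (k.+1%:R * t).
rewrite big_ord_recr /= -natr1 mulrDl mul1r.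
by have [->|->] := ceil_add_cases _ (k%:R * t) _ st; nra.
Qed.

Lemma sum_natr k : \sum_(l < k) l%:R = k%:R * (k%:R - 1) / 2 :> R.
Proof.
elim: k => [|k IH]; first by rewrite big_ord0; lra.
by rewrite big_ord_recr /= IH -natr1; field.
Qed.

Lemma sum_natrS k : \sum_(l < k) l.+1%:R = k%:R * (k%:R + 1) / 2 :> R.
Proof.
elim: k => [|k IH]; first by rewrite big_ord0; lra.
by rewrite big_ord_recr /= IH -natr1; field.
Qed.

(** Both sides count the pairs [(l, d)] with [1 <= l] and [l t <= d < N]: by columns on the left,
    and by rows on the right, where row [l] has [N - ceil (l t)] points. The induction adds one
    column at a time; [1 <= t] lets at most one new row start. *)
Lemma sum_floor_divE t N j : 1 <= t -> Num.floor (N%:R / t) = j%:Z ->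
  \sum_(d < N) (Num.floor (d%:R / t))%:~R =
    j%:R * N%:R - \sum_(l < j) (Num.ceil (l.+1%:R * t))%:~R :> R.
Proof.
move=> t1; have t0 : 0 < t by lra.
elim: N j => [|N IH] j; first by rewrite mul0r floor0 => -[<-]; rewrite !big_ord0 mul0r subr0.
have : 0 <= Num.floor (N%:R / t) by rewrite floor_ge0; apply: divr_ge0; rewrite // ltW.
case iE: (Num.floor (N%:R / t)) => [i|//] _ jE.
rewrite big_ord_recr /= (IH _ iE) iE -pmulrn.
have := floor_itv (N.+1%:R / t); have := floor_itv (N%:R / t).
rewrite iE jE !intrD -!pmulrn !ler_pdivlMr ?ltr_pdivrMr // -natr1.
move=> /andP[i1 i2] /andP[j1 j2].
have [ij|ij] : j = i \/ j = i.+1.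
  have : (i < j.+1)%N by rewrite -(ltr_nat R) -natr1; nra.
  have : (j < i.+2)%N by rewrite -(ltr_nat R) -!natr1; nra.
  lia.
  by rewrite ij; ring.
(* The new row [i + 1] starts just past the last column: [N < (i + 1) t <= N + 1], so it contributes
   zero. *)
rewrite ij big_ord_recr /= (_ : Num.ceil (i.+1%:R * t) = N.+1%:Z) -?pmulrn -?natr1; first by ring.
by apply: ceil_def; rewrite intrB -!pmulrn -!natr1; rewrite ij -natr1 in j1; lra.
Qed.

(** The same double count for the pairs [0 <= l], [l t < d <= N]: row [l] has [N - floor (l t)]
    points. *)
Lemma sum_ceil_divE t N k : 1 <= t -> Num.ceil (N%:R / t) = k%:Z ->
  \sum_(d < N) (Num.ceil (d.+1%:R / t))%:~R =
    k%:R * N%:R - \sum_(l < k) (Num.floor (l%:R * t))%:~R :> R.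
Proof.
move=> t1; have t0 : 0 < t by lra.
elim: N k => [|N IH] j; first by rewrite mul0r ceil0 => -[<-]; rewrite !big_ord0 mul0r subr0.
have : 0 <= Num.ceil (N%:R / t).
  rewrite ceil_ge0; apply: (@lt_le_trans _ _ 0); first by lra.
  by apply: divr_ge0; rewrite // ltW.
case iE: (Num.ceil (N%:R / t)) => [i|//] _ jE.
rewrite big_ord_recr /= (IH _ iE) jE -pmulrn.
have := ceil_itv (N.+1%:R / t); have := ceil_itv (N%:R / t).
rewrite iE jE !intrB -!pmulrn !ltr_pdivlMr ?ler_pdivrMr // -natr1.
move=> /andP[i1 i2] /andP[j1 j2].
have [ij|ij] : j = i \/ j = i.+1.
  have : (i < j.+1)%N by rewrite -(ltr_nat R) -natr1; nra.
  have : (j < i.+2)%N by rewrite -(ltr_nat R) -!natr1; nra.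
  lia.
  by rewrite ij; ring.
rewrite ij big_ord_recr /= (_ : Num.floor (i%:R * t) = N%:Z) -?pmulrn -?natr1; first by ring.
by apply: floor_def; rewrite intrD -!pmulrn; rewrite ij -natr1 in j1; lra.
Qed.

(* With e = t - s, a and b below are the numbers of carries in the two sums. *)
Lemma defect_le t r s k j : (1 < r)%N -> t ^+ 2 = r%:R ->
  s%:R <= t < s%:R + 1 -> (k + j)%N = s ->
  t * (t - s%:R) * (s%:R + 1 - t) / 2 <=
    \sum_(l < k) (l%:R * t - (Num.floor (l%:R * t))%:~R) +
    \sum_(l < j) ((Num.ceil (l.+1%:R * t))%:~R - l.+1%:R * t) +
    (t - s%:R) * (k%:R * t - (Num.floor (k%:R * t))%:~R).
Proof.
move=> r1 t2 st kjs; have /andP[st1 st2] := st.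
have hF := sum_frac_ge _ _ k st; have hG := sum_ceil_ge _ _ j st.
set F := \sum_(l < k) _ in hF *; set G := \sum_(l < j) _ in hG *.
have /andP[f1 f2] := floor_itv (k%:R * t); have /andP[g1 g2] := ceil_itv (j%:R * t).
rewrite intrD in f2; rewrite intrB in g1.
have sE : s%:R = k%:R + j%:R :> R by rewrite -natrD kjs.
have Mk0 : s%:Z * k%:Z <= Num.floor (k%:R * t).
  by rewrite floor_ge_int intrM -!pmulrn mulrC ler_wpM2l.
have Mj0 : s%:Z * j%:Z <= Num.ceil (j%:R * t).
  rewrite -(ler_int R) intrM -!pmulrn; apply: le_trans g2.
  by rewrite mulrC ler_wpM2l.
have [a aE] : exists a : nat, Num.floor (k%:R * t) = s%:Z * k%:Z + a%:Z.
  by exists (absz (Num.floor (k%:R * t) - s%:Z * k%:Z)%R); rewrite gez0_abs ?subr_ge0 // addrC subrK.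
have [b bE] : exists b : nat, Num.ceil (j%:R * t) = s%:Z * j%:Z + b%:Z.
  by exists (absz (Num.ceil (j%:R * t) - s%:Z * j%:Z)%R); rewrite gez0_abs ?subr_ge0 // addrC subrK.
move: f1 f2 g1 g2 hF hG.
rewrite aE bE !intrD !intrM -!pmulrn.
set e := t - s%:R; have tE : t = k%:R + j%:R + e by rewrite /e sE; ring.
rewrite sE in st1 st2 * => f1 f2 g1 g2 hF hG.
rewrite tE in f1 f2 g1 g2 hF hG.
have e0 : 0 <= e by lra.
have e1 : e < 1 by lra.
have e2 : e ^+ 2 <= 1 by rewrite exprn_ile1 // ltW.
set f := k%:R * e - a%:R.
have f0 : 0 <= f by rewrite /f; lra.
have fl1 : f < 1 by rewrite /f; lra.
have g0 : 0 <= b%:R - j%:R * e by lra.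
have FE : (1 - e) * a%:R <= F by lra.
have GE : (1 - e) * b%:R <= G by lra.
rewrite (_ : _ * _ - _ = f); last by rewrite tE /f; ring.
(* With at least two carries, [k e < a + 1], [j e <= b] and [e ^+ 2 <= 1] give
   [t e < a + b + 2 <= 2 (a + b)]. *)
have [M2|] := leqP 2 (a + b).
  have M2R : 2 <= a%:R + b%:R :> R by rewrite -natrD ler_nat.
  have : 0 <= e * f by rewrite mulr_ge0.
  have : (1 - e) * (t * e / 2) <= (1 - e) * (a%:R + b%:R).
    apply: ler_wpM2l; first by lra.
    by rewrite tE; rewrite /f in fl1; lra.
  by rewrite tE; lra.
rewrite leq_eqVlt => /orP[/eqP [M1]|].
  have ab : a%:R + b%:R = 1 :> R by rewrite -natrD M1.
  have FG : 1 - e <= F + G.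
    by apply: le_trans (lerD FE GE); rewrite -mulrDr ab mulr1.
  (* One carry gives [(k + j) e <= 1 + f]. What remains is [(1 - e) (1 - e^2 - f) + 2 e f >= 0],
     whose left side is the sum of the last three products. *)
  have : 0 <= (1 - e) * (1 + f - (k%:R + j%:R) * e) by apply: mulr_ge0; rewrite ?/f; lra.
  have : 0 <= (1 - e) * (1 - e ^+ 2) * (1 - f) by rewrite !mulr_ge0 //; lra.
  have : 0 <= e * f * (2 - e) by rewrite !mulr_ge0 //; lra.
  have : 0 <= e * f * e ^+ 2 by rewrite !mulr_ge0 // exprn_ge0.
  rewrite tE; lra.
rewrite !ltnS leqn0 addn_eq0 => /andP[/eqP a00 /eqP b00].
have F0 : 0 <= F by apply: sumr_ge0 => l _; rewrite subr_ge0 floor_le.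
have G0 : 0 <= G by apply: sumr_ge0 => l _; rewrite subr_ge0 ceil_ge.
(* No carry: if [e > 0], then [j e <= b = 0] forces [j = 0] and [s = k], so that [{l t} >= l e] for
   [l < k]. *)
have [e00|ep] := eqVneq e 0; first by rewrite e00; lra.
have {}ep : 0 < e by rewrite lt_neqAle eq_sym ep.
have j00 : j = 0%N.
  apply/eqP; rewrite -leqn0 -(ler_nat R) -(ler_pM2r ep) mul0r.
  by move: g0; rewrite b00; lra.
have jR : j%:R = 0 :> R by rewrite j00.
have fE : f = k%:R * e by rewrite /f a00 subr0.
have FE' : e * (k%:R * (k%:R - 1) / 2) <= F.
  rewrite -sum_natr mulr_sumr; apply: ler_sum => l _.
  have : Num.floor (l%:R * t) <= (l * k)%N%:Z.
    rewrite -ltzD1 floor_lt_int intrD -pmulrn natrM tE jR.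
    have : l%:R * e <= k%:R * e by rewrite ler_pM2r // ler_nat ltnW.
    lra.
  rewrite -(ler_int R) -pmulrn natrM tE jR; lra.
have t22 : 2 <= t ^+ 2 by rewrite t2 ler_nat.
have [k2|] := leqP 2 k.
  have k2R : 2 <= k%:R :> R by rewrite ler_nat.
  have : 0 <= e * (k%:R * (k%:R - 2)) by rewrite !mulr_ge0 //; lra.
  have : 0 <= e * (e * (3 * k%:R - 1)) by rewrite !mulr_ge0 //; lra.
  have : 0 <= e * (e * e) by rewrite !mulr_ge0 //; lra.
  rewrite tE fE jR; lra.
(* Here [2 <= t ^+ 2] decides: it excludes [k = 0], and for [k = 1] the bound is equivalent to
   [(1 + e) ^+ 2 >= 2] when [e > 0]. *)
case: (k) => [|[|//]] in tE fE FE' *; rewrite tE fE jR in t22 *; first by lra.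
move=> _; have : 0 <= e * ((1 + e) ^+ 2 - 2) by rewrite mulr_ge0 //; lra.
lra.
Qed.

End BeattySums.

(** * Floor sums over a window of [r] points spaced by [1 / t] *)

Lemma floorB (R : archiRealDomainType) (u v : R) :
  v - (Num.floor v)%:~R <= u - (Num.floor u)%:~R ->
  Num.floor (u - v) = Num.floor u - Num.floor v.
Proof.
move=> vu; apply: floor_def; rewrite !intrD intrN.
have /andP[u1 u2] := floor_itv u; have /andP[v1 v2] := floor_itv v.
by rewrite intrD in u2; rewrite intrD in v2; lra.
Qed.

Section WindowSums.
Variables (R : archiRealFieldType) (t : R) (r : nat).
Hypotheses (r_gt1 : (1 < r)%N) (t_ge0 : 0 <= t) (t_sqr : t ^+ 2 = r%:R).

Lemma root_gt1 : 1 < t.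
Proof.
rewrite ltNge; apply/negP => t1.
by have := exprn_ile1 2 t_ge0 t1; rewrite t_sqr lern1 leqNgt r_gt1.
Qed.

(** Splitting at [j = i] leaves floors of [d / t] for [d < m = r - i] and negated ceilings of
    [d / t] for [1 <= d <= i]. The lattice counts then reduce the claim to [defect_le]. *)
Lemma sum_floor_sub_le i : (i < r)%N ->
  \sum_(j < r) (Num.floor ((j%:R - i%:R) / t))%:~R
    <= r%:R * (t - 1) / 2 - t * i%:R.
Proof.
move=> ir; have t1 := root_gt1; have t0 : 0 < t by lra.
have [m rE] : exists m, r = (i + m)%N by exists (r - i)%N; rewrite subnKC // ltnW.
have tE : t ^+ 2 = i%:R + m%:R by rewrite t_sqr rE natrD.
rewrite (_ : \sum_(j < r) _ = \sum_(j < i + m) (Num.floor ((j%:R - i%:R) / t))%:~R); last by rewrite -rE.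
rewrite big_split_ord /=.
rewrite (eq_bigr (fun j : 'I_m => (Num.floor (j%:R / t))%:~R)); last first.
  by move=> j _; rewrite natrD addrAC subrr add0r.
rewrite (reindex_inj rev_ord_inj) /=.
rewrite (eq_bigr (fun j : 'I_i => - (Num.ceil (j.+1%:R / t))%:~R)); last first.
  by move=> j _; rewrite natrB ?(ltn_ord j) // addrAC subrr add0r mulNr floorNceil opprK intrN.
rewrite sumrN.
have j0 : 0 <= Num.floor (m%:R / t) by rewrite floor_ge0; apply: divr_ge0; rewrite // ltW.
have K0 : 0 <= Num.ceil (i%:R / t).
  rewrite ceil_ge0; apply: (@lt_le_trans _ _ 0); first by lra.
  by apply: divr_ge0; rewrite // ltW.
have s0 : 0 <= Num.floor t by rewrite floor_ge0.
case jE: (Num.floor (m%:R / t)) j0 => [j|//] _.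
case KE: (Num.ceil (i%:R / t)) K0 => [K|//] _.
case sE: (Num.floor t) s0 => [s|//] _.
rewrite (sum_floor_divE _ _ _ _ (ltW t1) jE) (sum_ceil_divE _ _ _ _ (ltW t1) KE).
have := floor_itv (m%:R / t); have := ceil_itv (i%:R / t); have := floor_itv t.
rewrite jE KE sE !intrB !intrD -!pmulrn.
rewrite ler_pdivlMr // ltr_pdivrMr // ltr_pdivlMr // ler_pdivrMr //.
move=> /andP[s1 s2] /andP[K1 K2] /andP[j1 j2].
(* Since [i + m = t ^+ 2], adding the bounds on [i / t] and [m / t] pins [K + j] to [s] or
   [s + 1]. *)
have sjK : (s < K + j + 1)%N.
  rewrite -(ltr_nat R) !natrD; apply: le_lt_trans s1 _.
  by rewrite -(ltr_pM2r t0) -expr2; lra.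
have jKs : (K + j < s + 2)%N.
  rewrite -(ltr_nat R) !natrD.
  suff : K%:R + j%:R - 1 < t by lra.
  by rewrite -(ltr_pM2r t0) -expr2; lra.
have js : (j < s + 1)%N.
  rewrite -(ltr_nat R) !natrD; apply: le_lt_trans s2.
  rewrite -(ler_pM2r t0) -expr2; have : 0 <= i%:R :> R by [].
  lra.
have [k [ksj Kk]] : exists k, (k + j)%N = s /\ (K = k \/ K = k.+1).
  exists (s - j)%N; lia.
have := defect_le _ _ _ _ k j r_gt1 t_sqr (introT andP (conj s1 s2)) ksj.
rewrite sumrB -mulr_suml sum_natr sumrB -mulr_suml sum_natrS.
have sR : s%:R = k%:R + j%:R :> R by rewrite -natrD ksj.
have /andP[f1 f2] := floor_itv (k%:R * t); rewrite intrD in f2.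
rewrite -t_sqr.
(* In either case the slack left by [defect_le] is exactly the product [h]. Its sign comes from
   [k t < i] if [K = k + 1], and from [i <= k t] if [K = k]. *)
case: Kk => Kk; rewrite Kk in K1 K2 *; last first.
  have h : 0 <= (s%:R + 1 - t) * (i%:R - (Num.floor (k%:R * t))%:~R).
    by apply: mulr_ge0; rewrite -[k.+1%:R]natr1 in K1; lra.
  rewrite big_ord_recr /= -[k.+1%:R]natr1.
  move: h; rewrite sR (_ : m%:R = t ^+ 2 - i%:R); last by rewrite tE; ring.
  lra.
have h : 0 <= (t - s%:R) * ((Num.floor (k%:R * t))%:~R - i%:R).
  apply: mulr_ge0; first by lra.
  by rewrite subr_ge0 (ler_int R i%:Z) floor_ge_int.
move: h; rewrite sR (_ : m%:R = t ^+ 2 - i%:R); last by rewrite tE; ring.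
lra.
Qed.

(** The index [i] minimizes the fractional part, so floors subtract exactly. The fractional part at
    [i] stays in the bound because strictness later depends on its being nonzero. *)
Lemma sum_floor_le y : exists i : 'I_r,
  \sum_(j < r) (Num.floor (y - j%:R / t))%:~R <=
    r%:R * y - r%:R / 2 - r%:R * t / 2 + t
      - r%:R * (y - i%:R / t - (Num.floor (y - i%:R / t))%:~R).
Proof.
have t1 := root_gt1; have t0 : 0 < t by lra.
pose p (j : 'I_r) := y - j%:R / t.
pose x j : R := p j - (Num.floor (p j))%:~R.
have i0 : 'I_r by exists 0%N; apply: leq_trans r_gt1.
have [i imin] : exists i, forall j, x i <= x j.
  by case: (@arg_minP _ _ _ i0 xpredT x) => // i _ h; exists i => j; apply: h.
exists i.
(* The differences are [(i - j) / t], of sign opposite to [sum_floor_sub_le], so the window is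
   reversed and [i] becomes [r - 1 - i]. *)
have ir : (r.-1 - i < r)%N by have := ltn_ord i; lia.
have := sum_floor_sub_le _ ir.
have irR : (r.-1 - i)%:R = r%:R - 1 - i%:R :> R.
  have ri := ltn_ord i; rewrite natrB; last by lia.
  by rewrite -subn1 natrB //; lia.
rewrite irR (reindex_inj rev_ord_inj) /=.
have h (j : 'I_r) : (Num.floor (y - j%:R / t))%:~R =
  (Num.floor (p i))%:~R + (Num.floor (((r - j.+1)%:R - (r%:R - 1 - i%:R)) / t))%:~R :> R.
  rewrite -intrD (_ : (_ - _) / t = p j - p i); last first.
    by rewrite natrB ?(ltn_ord j) // -natr1 /p; field; lra.
  by rewrite (floorB _ _ _ (imin j)) -/(p j); ring.
rewrite [X in _ -> X <= _](eq_bigr _ (fun j _ => h j)) big_split /= sumr_const card_ord -[_%:~R *+ r]mulr_natl.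
rewrite -/(p i) => H.
rewrite (_ : r%:R * y = r%:R * p i + t * i%:R); first by lra.
by rewrite /p -t_sqr; field; lra.
Qed.

Lemma sum_floor_ge y : exists i : 'I_r,
    r%:R * y - r%:R * (t - 1) / 2
      - r%:R * (y - i%:R / t - (Num.floor (y - i%:R / t))%:~R)
    <= \sum_(j < r) (Num.floor (y - j%:R / t))%:~R.
Proof.
have t1 := root_gt1; have t0 : 0 < t by lra.
pose p (j : 'I_r) := y - j%:R / t.
pose x j : R := p j - (Num.floor (p j))%:~R.
have i0 : 'I_r by exists 0%N; apply: leq_trans r_gt1.
have [i imax] : exists i, forall j, x j <= x i.
  by case: (@arg_maxP _ _ _ i0 xpredT x) => // i _ h; exists i => j; apply: h.
exists i.
have := sum_floor_sub_le _ (ltn_ord i).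
have h (j : 'I_r) : (Num.floor (y - j%:R / t))%:~R =
  (Num.floor (p i))%:~R - (Num.floor ((j%:R - i%:R) / t))%:~R :> R.
  rewrite -intrB (_ : (_ - _) / t = p i - p j); last by rewrite /p; field; lra.
  by rewrite (floorB _ _ _ (imax j)) -/(p j); ring.
rewrite [X in _ -> _ <= X](eq_bigr _ (fun j _ => h j)) sumrB sumr_const card_ord -[_%:~R *+ r]mulr_natl.
rewrite -/(p i) => H.
rewrite (_ : r%:R * y = r%:R * p i + t * i%:R); first by lra.
by rewrite /p -t_sqr; field; lra.
Qed.

End WindowSums.

(** * Arithmetic of integer points *)

(** With [m = n - i], nonnegative by [r <= n], clearing [t] and squaring gives
    [(2 m + r)^2 = (2 z)^2 r] in integers. Hence [2 |z|] divides [2 m + r], and the quotient [q] has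
    [q^2 = r]; as [2 m + r] is even, so are [r] and [q]. *)
Lemma integer_point_even_square (R : realFieldType) (t : R) (r i : nat) (n z : int) :
  t ^+ 2 = r%:R -> (i < r)%N -> r%:Z <= n ->
  (n - i%:Z)%:~R / t + t / 2 = z%:~R -> even_square r.
Proof.
move=> t2 ir rn zE.
have [m nE] : exists m : nat, n = i%:Z + m%:Z.
  by exists `|n - i%:Z|%N; lia.
have r0 : (0 < r)%N by apply: leq_ltn_trans ir.
have tn0 : t != 0 by rewrite -(sqrf_eq0 t) t2 pnatr_eq0 -lt0n.
have : ((2 * m + r)%:Z)%:~R = 2 * (z%:~R * t) :> R.
  rewrite -zE nE addrAC subrr add0r -!pmulrn natrD natrM -t2.
  by field.
move=> /(congr1 (fun x => x ^+ 2)); rewrite !exprMn t2.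
have -> : 2 ^+ 2 * (z%:~R ^+ 2 * r%:R) = ((2 * z) ^+ 2 * r%:Z)%:~R :> R.
  by rewrite !intrM; ring.
rewrite -rmorphXn => /intr_inj /(congr1 absz).
rewrite abszX abszM abszX abszM !absz_nat => E.
have N0 : (0 < 2 * m + r)%N by lia.
have /dvdnP[q qE] : (2 * `|z| %| 2 * m + r)%N by rewrite -(dvdn_pexp2r _ _ (ltn0Sn 1)) E dvdn_mulr.
have rq : r = (q ^ 2)%N.
  move/eqP: E; rewrite qE expnMn mulnC eqn_pmul2l; first by move=> /eqP.
  by rewrite expn_gt0; move: N0; rewrite qE muln_gt0 => /andP[_ ->].
exists q; split => //.
move/(congr1 odd): qE; rewrite oddD !oddM /= andbF rq oddX /=.
by move=> ->.
Qed.

(** * The value of [a] at [S(n)] *)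

Section IteratedWindow.
Variables (R : realType) (r : nat).
Hypothesis r_gt1 : (1 < r)%N.
Let t : R := Num.sqrt r%:R.

Let t_ge0 : 0 <= t := sqrtr_ge0 _.

Let t_sqr : t ^+ 2 = r%:R.
Proof. by rewrite sqr_sqrtr. Qed.

Let t_gt0 : 0 < t := lt_trans ltr01 (root_gt1 _ _ _ r_gt1 t_ge0 t_sqr).

Let t_neq0 : t != 0 := lt0r_neq0 t_gt0.

Lemma SsumE n : (Ssum R r n)%:~R =
  \sum_(j < r) (Num.floor (n%:~R / t + t / 2 - j%:R / t))%:~R :> R.
Proof.
rewrite /Ssum rmorph_sum /=; apply: eq_bigr => j _.
by rewrite /aseq -/t; congr (Num.floor _)%:~R; rewrite intrB -pmulrn; field; exact: t_neq0.
Qed.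

Lemma aseq_arg_le n : exists i : 'I_r,
  let p := (n - i%:Z)%:~R / t + t / 2 in
  (Ssum R r n)%:~R / t + t / 2 <= n%:~R + 1 - t * (p - (Num.floor p)%:~R).
Proof.
have [i iP] := sum_floor_le _ _ _ r_gt1 t_ge0 t_sqr (n%:~R / t + t / 2).
exists i => p; rewrite SsumE.
have pE : p = n%:~R / t + t / 2 - i%:R / t.
  by rewrite /p intrB -pmulrn; field; exact: t_neq0.
rewrite -pE in iP.
rewrite -lerBrDr ler_pdivrMr //; apply: le_trans iP _.
by rewrite le_eqVlt -t_sqr; apply/orP; left; apply/eqP; field; exact: t_neq0.
Qed.

Lemma aseq_arg_ge n : exists i : 'I_r,
  let p := (n - i%:Z)%:~R / t + t / 2 in
  n%:~R + t * (1 - (p - (Num.floor p)%:~R)) <= (Ssum R r n)%:~R / t + t / 2.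
Proof.
have [i iP] := sum_floor_ge _ _ _ r_gt1 t_ge0 t_sqr (n%:~R / t + t / 2).
exists i => p; rewrite SsumE.
have pE : p = n%:~R / t + t / 2 - i%:R / t.
  by rewrite /p intrB -pmulrn; field; exact: t_neq0.
rewrite -pE in iP.
rewrite -lerBlDr ler_pdivlMr //; apply: le_trans iP.
by rewrite le_eqVlt -t_sqr; apply/orP; left; apply/eqP; field; exact: t_neq0.
Qed.

(** A fractional part is below 1, so the lower bound is at least [n]; the upper bound is strictly
    below [n + 1] because no point of the window is an integer. *)
Lemma aseq_Ssum n : ~ even_square r -> r%:Z <= n -> aseq R r (Ssum R r n) = n.
Proof.
move=> nsq rn; have [i iP] := aseq_arg_le n; have [j jP] := aseq_arg_ge n.
apply: floor_def; rewrite intrD -/t; apply/andP; split.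
  apply: le_trans jP; rewrite lerDl mulr_ge0 //; set p := _ + t / 2.
  by have := floorD1_gt p; rewrite intrD; lra.
apply: le_lt_trans iP _; rewrite ltrBlDr ltrDl mulr_gt0 // subr_gt0.
rewrite lt_neqAle floor_le andbT; apply/eqP => /esym zE; apply: nsq.
exact: integer_point_even_square t_sqr (ltn_ord i) rn zE.
Qed.

(** Now [t = s] and [s / 2] is an integer, so every [t p] is an integer. Thus [t (1 - {p})] is a
    positive integer, hence at least 1, which raises the lower bound to [n + 1]. *)
Lemma aseq_Ssum_even_square n : even_square r -> aseq R r (Ssum R r n) = n + 1.
Proof.
move=> [s [es rs]]; have [i iP] := aseq_arg_le n; have [j jP] := aseq_arg_ge n.
have tE : t = s%:R by rewrite /t rs natrX sqrtr_sqr ger0_norm.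
apply: floor_def; rewrite !intrD -/t; apply/andP; split; last first.
  apply: le_lt_trans iP _; set p := _ + t / 2.
  have : 0 <= t * (p - (Num.floor p)%:~R) by rewrite mulr_ge0 // subr_ge0 floor_le.
  lra.
apply: le_trans jP; rewrite lerD2l; set p := _ + t / 2.
pose w : int := n - j%:Z + s%:Z * (s./2)%:Z.
have tpE : t * p = w%:~R.
  have sE : s%:R = 2 * (s./2)%:R :> R.
    by rewrite -natrM mul2n even_halfK.
  rewrite /p /w intrD intrM -!pmulrn mulrDr mulrCA divff ?gt_eqF // mulr1 -tE.
  by rewrite {2}tE sE; field.
have -> : t * (1 - (p - (Num.floor p)%:~R)) = (s%:Z - w + s%:Z * Num.floor p)%:~R.
  by rewrite !intrD intrM intrN -tpE -!pmulrn -tE; ring.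
rewrite (ler_int R 1) -gtz0_ge1 -(ltr_int R).
rewrite !intrD intrM intrN -tpE -!pmulrn -tE.
rewrite (_ : _ + _ = t * (1 + (Num.floor p)%:~R - p)); last by ring.
by apply: mulr_gt0 => //; have := floorD1_gt p; rewrite intrD; lra.
Qed.

End IteratedWindow.

Theorem theorem3p1 (R : realType) (r : nat) (hr : (2 <= r)%N) :
  [/\ ~ even_square r ->
        forall n : int, r%:Z <= n -> aseq R r (Ssum R r n) = n,
      even_square r ->
        forall n : int, r%:Z <= n -> aseq R r (Ssum R r n) = n + 1
    & (exists s : nat, odd s /\ r = (s ^ 2)%N) ->
        forall n : int, r%:Z <= n -> aseq R r (Ssum R r n) = n].
Proof.
split=> [nsq n rn|sq n _|[s [os rs]] n rn].
- exact: aseq_Ssum.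
- exact: aseq_Ssum_even_square.
- apply: aseq_Ssum => // -[s' [es rs']].
  by move/(congr1 odd): rs; rewrite rs' !oddX /= os (negbTE es).
Qed.
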